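(* (i) For every cyclic formula $\phi$, $\mathsf{CHL}\vdash\phi\leftrightarrow\langle\phi/\phi\rangle$. (ii) For every cyclic formula $\psi$ modalised in $p$, $\mathsf{CHL}\vdash\digamma p.\psi\leftrightarrow\psi[p:\digamma p.\psi]$.
   Context: Labels: $\bot,\top$ and propositional variables (arity 0), $\neg,\Box$ (arity 1), $\wedge,\vee,\to$ (arity 2). A graph is $\langle V,r,S,\lambda\rangle$ with $V$ finite, root $r$, labelling $\lambda$, $S:V\to V^{*}$ ordered successors (length = arity of label); every vertex reachable from $r$. A cycle is a set of pairwise distinct vertices each followed by a successor, closing up. A (cyclic) formula is a graph in which every cycle contains a $\Box$-labelled vertex. Bisimulation: $aRa'$ implies equal labels and $i$-th successors related; $\simeq$ = bisimilarity relating roots. $\phi[p:\psi]$: disjoint union identifying each $p$-labelled vertex of $\phi$ with the root of $\psi$ (keeping that root's label). $\psi$ modalised in $p$: every path from root to a $p$-labelled vertex contains a $\Box$-labelled vertex; $\digamma p.\psi$ identifies the root with all $p$-labelled vertices (keeping the root's label). For $q$ not occurring in $\phi$: if the root $r$ of $\phi$ is on no cycle, $\langle\phi/q\rangle:=\phi$; otherwise add a fresh vertex labelled $q$ without successors and redirect every edge into $r$ to it (root still $r$). $\langle\phi/\chi\rangle:=\langle\phi/q\rangle[q:\chi]$. $\mathsf{CHL}$: least set of cyclic formulas containing all substitution instances of propositional tautologies, all $\Box(\phi\to\psi)\to(\Box\phi\to\Box\psi)$, all $\phi\leftrightarrow\psi$ with $\phi\simeq\psi$, closed under modus ponens, necessitation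 and Löb's rule (from $\vdash\Box\phi\to\phi$ infer $\vdash\phi$). *)

(* Defs.v *)
From HB Require Import structures.
From mathcomp Require Import all_boot.

Set Implicit Arguments.
Unset Strict Implicit.
Unset Printing Implicit Defensive.

Inductive label : Type :=
  | LBot | LTop | LVar of nat | LNeg | LBox | LAnd | LOr | LImp.

Lemma label_eq_dec : comparable label.
Proof. by move=> x y; rewrite /decidable; decide equality; apply: eq_comparable. Qed.

HB.instance Definition _ := comparableMixin label_eq_dec.

Definition arity (l : label) : nat :=
  match l with
  | LBot | LTop | LVar _ => 0
  | LNeg | LBox => 1
  | LAnd | LOr | LImp => 2
  end.

(* Pointed labelled graphs, where unreachable vertices are still allowed. *)
Record pregraph : Type := PreGraph {
  vertex :> finType;
  gr_root : vertex;
  lab : vertex -> label;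
  succ : vertex -> seq vertex;
  size_succ : forall v, size (succ v) = arity (lab v) }.

Arguments lab {p} v : rename.
Arguments succ {p} v : rename.

Definition edge (g : pregraph) : rel g := fun v w => w \in succ v.
Arguments edge g : clear implicits.

Definition is_box (g : pregraph) (v : g) : bool := lab v == LBox.

Definition reachable (g : pregraph) : Prop :=
  forall v : g, connect (edge g) (gr_root g) v.

Definition guarded (g : pregraph) : Prop :=
  forall c : seq g, c != [::] -> ucycle (edge g) c -> has (@is_box g) c.

Record cformula : Type := CFormula {
  cgraph :> pregraph;
  cformula_reachable : reachable cgraph;
  cformula_guarded : guarded cgraph }.

Definition occurs (p : nat) (phi : cformula) : bool :=
  [exists v : phi, lab v == LVar p].

Definition is_bisimulation (g h : pregraph) (R : g -> h -> Prop) : Prop :=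
  forall (a : g) (a' : h), R a a' ->
    lab a = lab a' /\
    forall i, i < arity (lab a) -> R (nth a (succ a) i) (nth a' (succ a') i).

Definition bisimilar (g h : pregraph) : Prop :=
  exists2 R : g -> h -> Prop, is_bisimulation R & R (gr_root g) (gr_root h).

(* A box-free closed walk contains a box-free cycle, so guardedness may be
   tested on walks with repetitions. *)
Lemma guarded_cycle (g : pregraph) : guarded g ->
  forall c : seq g, c != [::] -> cycle (edge g) c -> has (@is_box g) c.
Proof.
move=> gg [//|x p] _ /=; rewrite rcons_path => /andP[].
case/shortenP=> p' pth uq sub last_e.
have: has (@is_box g) (x :: p').
  by apply: gg => //; rewrite /ucycle /= rcons_path pth last_e.
case/orP=> [-> //|/hasP[y /sub yp yb]].
by apply/orP; right; apply/hasP; exists y.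
Qed.

(* Guardedness is reflected along maps that preserve labels and edges. *)
Lemma guarded_map (g h : pregraph) (f : h -> g) : guarded g ->
  (forall v, lab (f v) = lab v) ->
  (forall v w, edge h v w -> edge g (f v) (f w)) ->
  guarded h.
Proof.
move=> gg fl fe c c0 /andP[cyc _].
have: has (@is_box g) (map f c).
  apply: (guarded_cycle gg); first by case: c c0 {cyc}.
  case: c cyc {c0} => //= x p; rewrite -map_rcons path_map.
  by apply: sub_path => v w /= /fe.
by rewrite has_map; apply: sub_has => v; rewrite /= /is_box fl.
Qed.

Section Generate.

Variable g : pregraph.

Let gvertex : finType := {v : g | connect (edge g) (gr_root g) v}.
Let groot : gvertex := exist _ (gr_root g) (connect0 (edge g) (gr_root g)).
Let glab (v : gvertex) : label := lab (val v).
(* The successors of a reachable vertex are reachable: the default value groot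
   of insubd is never used, see val_generate_succ. *)
Let gsucc (v : gvertex) : seq gvertex :=
  [seq insubd groot w | w <- succ (val v)].

Lemma generate_size v : size (gsucc v) = arity (glab v).
Proof. by rewrite size_map size_succ. Qed.

Definition generate : pregraph :=
  @PreGraph gvertex groot glab gsucc generate_size.

Lemma val_generate_succ (v : generate) :
  [seq val w | w <- succ v] = succ (val v).
Proof.
rewrite -map_comp -[RHS]map_id; apply/eq_in_map => w wv /=.
rewrite val_insubd; case: ifPn => // /negP[].
by apply: (connect_trans (valP v)); apply: connect1.
Qed.

Lemma generate_edge (v w : generate) :
  edge generate v w = edge g (val v) (val w).
Proof. by rewrite /edge -val_generate_succ mem_map //; apply: val_inj. Qed.

Lemma generate_reachable : reachable generate.
Proof.
move=> v; have /connectP[p] := valP v.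
elim/last_ind: p v => [|p x IH] v /=.
  by move=> _ ev; rewrite (_ : v = groot) ?connect0 //; apply: val_inj.
rewrite rcons_path last_rcons => /andP[pth e] ev.
have cu : connect (edge g) (gr_root g) (last (gr_root g) p).
  by apply/connectP; exists p.
pose u : generate := exist (fun w => connect (edge g) (gr_root g) w) _ cu.
have /connect_trans : connect (edge generate) (gr_root generate) u by apply: IH.
by apply; apply: connect1; rewrite generate_edge /= ev.
Qed.

Lemma generate_guarded : guarded g -> guarded generate.
Proof.
move=> gg; apply: (guarded_map (f := (val : generate -> g))) => // v w.
by rewrite generate_edge.
Qed.

Definition generated (gg : guarded g) : cformula :=
  CFormula generate_reachable (generate_guarded gg).

End Generate.

Section Connectives.

Lemma leaf_size (l : label) (hl : arity l = 0) (v : unit) :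
  size (Nil unit) = arity l.
Proof. by rewrite hl. Qed.

Definition leaf_graph (l : label) (hl : arity l = 0) : pregraph :=
  @PreGraph unit tt (fun _ => l) (fun _ => [::]) (leaf_size hl).

Lemma leaf_guarded l (hl : arity l = 0) : guarded (leaf_graph hl).
Proof. by case=> [//|x [|y p]] _ /andP[] /=. Qed.

Definition leaf l (hl : arity l = 0) : cformula := generated (@leaf_guarded l hl).

Lemma unary_size l (hl : arity l = 1) (phi : cformula) (v : option phi) :
  size (if v is Some a then [seq Some b | b <- succ a] else [:: Some (gr_root phi)])
  = arity (if v is Some a then lab a else l).
Proof. by case: v => [a|]; rewrite ?size_map ?size_succ ?hl. Qed.

Definition unary_graph l (hl : arity l = 1) (phi : cformula) : pregraph :=
  @PreGraph (option phi) None
    (fun v => if v is Some a then lab a else l)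
    (fun v => if v is Some a then [seq Some b | b <- succ a]
              else [:: Some (gr_root phi)])
    (@unary_size l hl phi).

Definition binary_succ (phi psi : cformula) (v : option (phi + psi)) :
    seq (option (phi + psi)) :=
  match v with
  | None => [:: Some (inl (gr_root phi)); Some (inr (gr_root psi))]
  | Some (inl a) => [seq Some (inl b) | b <- succ a]
  | Some (inr a) => [seq Some (inr b) | b <- succ a]
  end.

Definition binary_lab l (phi psi : cformula) (v : option (phi + psi)) : label :=
  match v with
  | None => l
  | Some (inl a) => lab a
  | Some (inr a) => lab a
  end.

Lemma binary_size l (hl : arity l = 2) (phi psi : cformula)
    (v : option (phi + psi)) :
  size (binary_succ v) = arity (binary_lab l v).
Proof. by case: v => [[a|a]|] /=; rewrite ?size_map ?size_succ ?hl. Qed.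

Definition binary_graph l (hl : arity l = 2) (phi psi : cformula) : pregraph :=
  @PreGraph (option (phi + psi)) None (@binary_lab l phi psi)
    (@binary_succ phi psi) (@binary_size l hl phi psi).

(* A cycle staying in the image of an embedding pulls back. *)
Lemma embed_cycle (g h : pregraph) (f : g -> h) (P : pred h) (c : seq h) :
  (forall v, lab (f v) = lab v) ->
  (forall x, P x -> exists a, x = f a) ->
  (forall a b, P (f a) -> P (f b) -> edge h (f a) (f b) -> edge g a b) ->
  guarded g -> c != [::] -> cycle (edge h) c -> all P c ->
  has (@is_box h) c.
Proof.
move=> fl fP fe gg c0 cyc allP.
have [d ed] : exists d, c = map f d.
  elim: c allP {c0 cyc} => [|x c IH] /=; first by exists [::].
  by case/andP=> /fP[a ->] /IH[d ->]; exists (a :: d).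
rewrite {}ed in c0 cyc allP *.
suff: has (@is_box g) d.
  by rewrite has_map; apply: sub_has => v; rewrite /= /is_box fl.
apply: (guarded_cycle gg); first by case: (d) c0.
case: d cyc allP {c0} => //= x p; rewrite -map_rcons path_map => pth aP.
have: all (P \o f) (x :: rcons p x).
  by case/andP: aP => h1; rewrite all_map /= all_rcons /= h1.
clear aP; move: (rcons p x) pth => r.
elim: r x => //= y q IH x /andP[exy pth] /and3P[Px Py aq].
by rewrite (fe _ _ Px Py exy) IH //= Py.
Qed.

Lemma closed_cycle (T : eqType) (e : rel T) (P : pred T) (c : seq T) x :
  (forall a b, a \in c -> P a -> e a b -> P b) ->
  cycle e c -> x \in c -> P x -> all P c.
Proof.
move=> cl cyc /rot_to[i s ers] Px.
have sc y : y \in x :: s -> y \in c by rewrite -ers mem_rot.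
rewrite -(eq_all_r (mem_rot i c)) ers; move: cyc; rewrite -(rot_cycle i) ers /= rcons_path.
case/andP=> pth _; rewrite Px /=.
elim: s x Px pth sc {ers} => //= y s IH x Px /andP[exy pth] sc.
have Py := cl _ _ (sc _ (mem_head _ _)) Px exy; rewrite Py (IH _ Py pth) //.
by move=> z zs; apply: sc; rewrite inE zs orbT.
Qed.

Lemma cycle_avoid (T : eqType) (e : rel T) (c : seq T) x :
  (forall a, ~~ e a x) -> cycle e c -> x \notin c.
Proof.
move=> nx cyc; apply/negP => /(prev_cycle cyc) e1.
by move: (nx (prev c x)); rewrite e1.
Qed.

Lemma unary_guarded l (hl : arity l = 1) phi : guarded (unary_graph hl phi).
Proof.
move=> c c0 /andP[cyc _].
have nN : None \notin c.
  apply: cycle_avoid cyc => -[a|]; rewrite /edge /= ?inE //.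
  by apply/mapP => -[].
apply: (@embed_cycle phi (unary_graph hl phi) Some isSome) => //.
- by case=> // a _; exists a.
- by move=> a b _ _; rewrite /edge /= mem_map // => ? ? [].
- exact: cformula_guarded.
- by apply/allP => -[] // nc; case/negP: nN.
Qed.

Lemma binary_guarded l (hl : arity l = 2) phi psi :
  guarded (binary_graph hl phi psi).
Proof.
move=> c c0 /andP[cyc _]; set h := binary_graph hl phi psi.
have nN : None \notin c.
  apply: cycle_avoid cyc => -[[a|a]|]; rewrite /edge /= ?inE //;
    by apply/mapP => -[].
case: c c0 cyc nN => // -[[x|x]|] c c0 cyc nN; last by rewrite inE in nN.
- pose P : pred h := fun v => if v is Some (inl _) then true else false.
  apply: (@embed_cycle phi h (fun a => Some (inl a)) P) => //.
  + by case=> [[a|]|] // _; exists a.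
  + by move=> a b _ _; rewrite /edge /= mem_map // => ? ? [].
  + exact: cformula_guarded.
  + apply: (closed_cycle _ cyc (mem_head _ _)) => // -[[a|a]|] b //= _ _.
    by case/mapP=> ? _ ->.
- pose P : pred h := fun v => if v is Some (inr _) then true else false.
  apply: (@embed_cycle psi h (fun a => Some (inr a)) P) => //.
  + by case=> [[a|a]|] // _; exists a.
  + by move=> a b _ _; rewrite /edge /= mem_map // => ? ? [].
  + exact: cformula_guarded.
  + apply: (closed_cycle _ cyc (mem_head _ _)) => // -[[a|a]|] b //= _ _.
    by case/mapP=> ? _ ->.
Qed.

Definition unary l (hl : arity l = 1) (phi : cformula) : cformula :=
  generated (@unary_guarded l hl phi).

Definition binary l (hl : arity l = 2) (phi psi : cformula) : cformula :=
  generated (@binary_guarded l hl phi psi).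

End Connectives.

Definition cBot : cformula := leaf (l := LBot) erefl.
Definition cTop : cformula := leaf (l := LTop) erefl.
Definition cNeg : cformula -> cformula := unary (l := LNeg) erefl.
Definition cBox : cformula -> cformula := unary (l := LBox) erefl.
Definition cAnd : cformula -> cformula -> cformula := binary (l := LAnd) erefl.
Definition cOr : cformula -> cformula -> cformula := binary (l := LOr) erefl.
Definition cImp : cformula -> cformula -> cformula := binary (l := LImp) erefl.
Definition cIff (phi psi : cformula) : cformula :=
  cAnd (cImp phi psi) (cImp psi phi).

Section Substitution.

Variables (p : nat) (phi psi : cformula).

(* The vertex of the disjoint union that a vertex of phi is identified with.
   The p-labelled vertices themselves are left behind without incoming edges;
   generated removes them, and removes psi when p does not occur in phi. *)
Definition subst_vertex (v : phi) : phi + psi :=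
  if lab v == LVar p then inr (gr_root psi) else inl v.

Definition subst_lab (v : phi + psi) : label :=
  match v with inl a => lab a | inr b => lab b end.

Definition subst_succ (v : phi + psi) : seq (phi + psi) :=
  match v with
  | inl a => [seq subst_vertex w | w <- succ a]
  | inr b => [seq inr w | w <- succ b]
  end.

Lemma subst_size v : size (subst_succ v) = arity (subst_lab v).
Proof. by case: v => a /=; rewrite size_map size_succ. Qed.

Definition subst_graph : pregraph :=
  @PreGraph (phi + psi)%type (subst_vertex (gr_root phi)) subst_lab subst_succ
    subst_size.

Lemma subst_guarded : guarded subst_graph.
Proof.
move=> c c0 /andP[cyc _].
pose Pr : pred subst_graph := fun v => if v is inr _ then true else false.
have clr a b : Pr a -> edge subst_graph a b -> Pr b.
  by case: a => // a _ /mapP[? _ ->].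
case: (boolP (has Pr c)) => [/hasP[x xc Px]|/hasPn nr].
  apply: (@embed_cycle psi subst_graph inr Pr) => //.
  + by case=> // a _; exists a.
  + by move=> a b _ _; rewrite /edge /= mem_map // => ? ? [].
  + exact: cformula_guarded.
  + by apply: closed_cycle cyc xc Px => a b _; apply: clr.
pose Pl : pred subst_graph := fun v => if v is inl _ then true else false.
apply: (@embed_cycle phi subst_graph inl Pl) => //.
+ by case=> // a _; exists a.
+ move=> a b _ _ /mapP[w wa]; rewrite /subst_vertex; case: ifP => // _ [->].
  exact: wa.
+ exact: cformula_guarded.
+ by apply/allP => -[] // b /nr.
Qed.

(* phi[p : psi] *)
Definition subst : cformula := generated subst_guarded.

End Substitution.

Definition modalised (p : nat) (psi : cformula) : Prop :=
  forall s : seq psi, path (edge psi) (gr_root psi) s ->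
    lab (last (gr_root psi) s) = LVar p -> has (@is_box psi) (gr_root psi :: s).

Section FixedPoint.

Variables (p : nat) (psi : cformula).

(* As for substitution, the p-labelled vertices are replaced by the root as
   targets of edges and then removed as unreachable. *)
Definition fix_vertex (v : psi) : psi :=
  if lab v == LVar p then gr_root psi else v.

Definition fix_succ (v : psi) : seq psi := [seq fix_vertex w | w <- succ v].

Lemma fix_size v : size (fix_succ v) = arity (lab v).
Proof. by rewrite size_map size_succ. Qed.

Definition fix_graph : pregraph :=
  @PreGraph psi (gr_root psi) (@lab psi) fix_succ fix_size.

Lemma fix_guarded : modalised p psi -> guarded fix_graph.
Proof.
move=> mod c c0 /andP[cyc _]; apply/negPn/negP => nb.
have nbx x : x \in c -> ~~ is_box (x : psi).
  by move=> xc; apply/negP => xb; move/hasPn/(_ x xc)/negP: nb; apply.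
pose e' : rel psi := fun x y => edge psi x y && ~~ is_box x.
have free s : path e' (gr_root psi) s -> ~~ is_box (last (gr_root psi) s) ->
    has (@is_box psi) (gr_root psi :: s) = false.
  elim: s (gr_root psi) => [|y s IH] x /=; first by rewrite orbF => _ /negPf.
  case/andP=> /andP[_ /negPf ->] pth nl /=; exact: IH.
have step x y : x \in c -> connect e' (gr_root psi) x -> edge psi x y ->
    lab y != LVar p.
  move=> xc /connectP[s pth ex] exy; apply/negP => /eqP ly.
  have pth' : path e' (gr_root psi) (rcons s y).
    by rewrite rcons_path pth /e' -ex exy nbx.
  have /mod : path (edge psi) (gr_root psi) (rcons s y).
    by apply: sub_path pth' => u w /andP[].
  have nl : ~~ is_box (last (gr_root psi) (rcons s y)).
    by rewrite last_rcons /is_box ly; apply/eqP.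
  by rewrite free // last_rcons => /(_ ly).
suff genuine x y : x \in c -> y \in c -> edge fix_graph x y -> edge psi x y.
  suff cyc' : cycle (edge psi) c.
    by move: nb; rewrite /= (guarded_cycle (@cformula_guarded psi) c0 cyc').
  by apply: (sub_in_cycle (P := mem c)) cyc => //; apply/allP.
move=> xc yc /mapP[w wx]; rewrite {1}/fix_vertex.
case: ifP => [/eqP lw yr|_ -> //].
have /allP/(_ x xc) Px : all (connect e' (gr_root psi)) c.
  apply: closed_cycle cyc _ (connect0 e' (gr_root psi)); last by rewrite -yr.
  move=> a b ac Pa /mapP[v va ->].
  rewrite /fix_vertex (negPf (step _ _ ac Pa va)).
  by apply: (connect_trans Pa); apply: connect1; rewrite /e' nbx // andbT.
by have := step _ _ xc Px wx; rewrite lw eqxx.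
Qed.

(* The fixed point of psi, for psi modalised in p. *)
Definition fixpoint (mod : modalised p psi) : cformula :=
  generated (fix_guarded mod).

End FixedPoint.

Definition on_cycle (g : pregraph) (v : g) : bool :=
  [exists w, edge g v w && connect (edge g) w v].

Lemma on_cycleP (g : pregraph) (v : g) :
  reflect (exists2 c : seq g, ucycle (edge g) c & v \in c) (on_cycle v).
Proof.
apply: (iffP existsP) => [[w /andP[evw /connectP[s]]]|[c /andP[cyc uc] vc]].
  case/shortenP=> s' pth us _ ev; have [vs|vs] := eqVneq v w.
    by exists [:: v]; rewrite ?mem_head // /ucycle /= {2}vs evw.
  exists (w :: s'); last by rewrite ev mem_last.
  by rewrite /ucycle us /= rcons_path pth -ev evw.
have [i s ers] := rot_to vc.
move: cyc; rewrite -(rot_cycle i) ers; case: s {ers} => [|y s] /=.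
  by rewrite andbT => evv; exists v; rewrite evv connect0.
case/andP=> evy pth; exists y; rewrite evy /=.
by apply/connectP; exists (rcons s v); rewrite ?last_rcons.
Qed.

Section Unwind.

Variables (phi : cformula) (q : nat).

Definition unwind_vertex (v : phi) : option phi :=
  if v == gr_root phi then None else Some v.

Definition unwind_lab (v : option phi) : label :=
  if v is Some a then lab a else LVar q.

Definition unwind_succ (v : option phi) : seq (option phi) :=
  if v is Some a then [seq unwind_vertex w | w <- succ a] else [::].

Lemma unwind_size v : size (unwind_succ v) = arity (unwind_lab v).
Proof. by case: v => [a|] //=; rewrite size_map size_succ. Qed.

Definition unwind_graph : pregraph :=
  @PreGraph (option phi) (Some (gr_root phi)) unwind_lab unwind_succ unwind_size.

Lemma unwind_guarded : guarded unwind_graph.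
Proof.
move=> c c0 /andP[cyc _].
apply: (@embed_cycle phi unwind_graph Some isSome) => //.
- by case=> // a _; exists a.
- move=> a b _ _ /mapP[w wa]; rewrite /unwind_vertex; case: ifP => // _ [->].
  exact: wa.
- exact: cformula_guarded.
- by apply/allP => -[] // /(next_cycle cyc).
Qed.

(* <phi / q>, meant for q not occurring in phi *)
Definition unwind : cformula :=
  if on_cycle (gr_root phi) then generated unwind_guarded else phi.

End Unwind.

(* <phi / chi>, computed through the variable q, which must not occur in phi *)
Definition unwind_subst (q : nat) (phi chi : cformula) : cformula :=
  subst q (unwind phi q) chi.

Inductive pform : Type :=
  | PVar of nat | PBot | PTop | PNeg of pform
  | PAnd of pform & pform | POr of pform & pform | PImp of pform & pform.

Fixpoint peval (e : nat -> bool) (t : pform) : bool :=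
  match t with
  | PVar x => e x
  | PBot => false
  | PTop => true
  | PNeg a => ~~ peval e a
  | PAnd a b => peval e a && peval e b
  | POr a b => peval e a || peval e b
  | PImp a b => peval e a ==> peval e b
  end.

Definition tautology (t : pform) : Prop := forall e, peval e t.

(* Each occurrence of a variable receives its own copy of the substituted
   formula; sharing copies gives a bisimilar graph. *)
Fixpoint pinst (s : nat -> cformula) (t : pform) : cformula :=
  match t with
  | PVar x => s x
  | PBot => cBot
  | PTop => cTop
  | PNeg a => cNeg (pinst s a)
  | PAnd a b => cAnd (pinst s a) (pinst s b)
  | POr a b => cOr (pinst s a) (pinst s b)
  | PImp a b => cImp (pinst s a) (pinst s b)
  end.

Inductive CHL : cformula -> Prop :=
  | CHL_taut s t : tautology t -> CHL (pinst s t)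
  | CHL_K phi psi :
      CHL (cImp (cBox (cImp phi psi)) (cImp (cBox phi) (cBox psi)))
  | CHL_bisim (phi psi : cformula) : bisimilar phi psi -> CHL (cIff phi psi)
  | CHL_mp (phi psi : cformula) : CHL (cImp phi psi) -> CHL phi -> CHL psi
  | CHL_nec phi : CHL phi -> CHL (cBox phi)
  | CHL_lob phi : CHL (cImp (cBox phi) phi) -> CHL phi.

(* Main.v *)
(** Both equivalences already hold up to bisimilarity: collapsing the copies in
    [<phi/phi>], respectively in [psi[p : F p. psi]], back onto the original
    graph preserves the root, the labels and the successors, so each is an
    instance of the bisimilarity axiom of CHL. *)

Require Import Defs.
From mathcomp Require Import all_boot.

Set Implicit Arguments.
Unset Strict Implicit.
Unset Printing Implicit Defensive.

Lemma bisimilar_sym (g h : pregraph) : bisimilar g h -> bisimilar h g.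
Proof.
case=> R Rbis Rroot; exists (fun b a => R a b) => // b a /Rbis[eqlab Rsucc].
by rewrite -eqlab.
Qed.

Lemma bisimilar_trans (g h k : pregraph) :
  bisimilar g h -> bisimilar h k -> bisimilar g k.
Proof.
case=> R Rbis Rroot [S Sbis Sroot].
exists (fun a c => exists2 b, R a b & S b c); last by exists (gr_root h).
move=> a c [b /Rbis[lab_ab Rsucc] /Sbis[lab_bc Ssucc]].
split=> [|i lt_i]; first by rewrite lab_ab.
by exists (nth b (succ b) i); [apply: Rsucc | apply: Ssucc; rewrite -lab_ab].
Qed.

(* [P] discards unreachable vertices, on which [f] need not preserve labels. *)
Lemma bisimilar_map (g h : pregraph) (f : g -> h) (P : pred g) :
    P (gr_root g) -> f (gr_root g) = gr_root h ->
    (forall v, P v -> [/\ lab (f v) = lab v, map f (succ v) = succ (f v)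
                        & all P (succ v)]) ->
  bisimilar g h.
Proof.
move=> Proot froot fP; exists (fun a b => P a /\ b = f a) => // a _ [Pa ->].
have [labf succf /allP Psucc] := fP a Pa; split=> // i lt_i.
have lt_si : i < size (succ a) by rewrite size_succ.
by rewrite -succf (nth_map a) //; split=> //; apply/Psucc/mem_nth.
Qed.

(** Lets the arguments below run on the raw graphs [subst_graph] and [fix_graph], before unreachable
    vertices are pruned. *)
Lemma bisimilar_generate (g : pregraph) : bisimilar (generate g) g.
Proof.
apply: (bisimilar_map (f := (val : generate g -> g)) (P := xpredT)) => // v _.
by rewrite val_generate_succ; split=> //; apply/allP.
Qed.

Lemma bisimilar_subst_unwind (q : nat) (phi : cformula) :
  ~~ occurs q phi ->
  bisimilar (subst_graph q (unwind phi q) phi) phi.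
Proof.
move=> /existsPn q_phi; rewrite /unwind; case: ifP => _; last first.
  (* Root on no cycle: as [q] does not occur in [phi], substitution redirects nothing. *)
  have vertexE w : @subst_vertex q phi phi w = inl w.
    by rewrite /subst_vertex (negPf (q_phi w)).
  apply: (bisimilar_map (g := subst_graph q phi phi) (P := xpredT)
           (f := fun v => match v with inl a => a | inr b => b end)) => /=.
  - by [].
  - by rewrite vertexE.
  - case=> a _; split; rewrite -?map_comp ?map_id //=; try exact/allP.
    by rewrite -[RHS]map_id; apply: eq_map => w /=; rewrite vertexE.
set u := generated _.
(* The fresh leaf [None] stands for the root of [phi], hence the default value. *)
pose back (v : option phi) := odflt (gr_root phi) v.
pose f (v : subst_graph q u phi) : phi :=
  match v with inl a => back (val a) | inr b => b end.
(* Excludes the leaf left behind by substitution: its label [q] differs from that of the root, its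
   image under [f]. *)
pose P (v : subst_graph q u phi) : bool :=
  match v with inl a => isSome (val a) | inr _ => true end.
have lab_u (w : u) : lab w = unwind_lab q (val w) by [].
(* Targets of edges avoid the leaf: it is replaced by the root of the second copy, which has the
   same image in [phi]. *)
have PfE (w : u) : P (subst_vertex q phi w) /\
                   f (subst_vertex q phi w) = back (val w).
  rewrite /subst_vertex lab_u; case: ifP => /=; case: (val w) => [a|] //=.
  - by rewrite (negPf (q_phi a)).
  - by rewrite eqxx.
apply: (bisimilar_map (f := f) (P := P)).
- by case: (PfE (gr_root u)).
- by case: (PfE (gr_root u)).
case=> [a|b _]; last first.
  split; rewrite //= -?map_comp ?map_id //.
  by apply/allP => _ /mapP[w _ ->].
rewrite /P => Pa; split.
- by change (lab (back (val a)) = unwind_lab q (val a)); case: (val a) Pa.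
- rewrite /= -map_comp (eq_map (fun w => (PfE w).2)).
  change (map (back \o val) (succ a) = succ (back (val a))).
  rewrite (map_comp back val) (val_generate_succ (a : generate _)).
  case: (val a) Pa => //= x _; rewrite -map_comp -[RHS]map_id.
  (* [back] undoes [unwind_vertex], since only the root is redirected to [None]. *)
  by apply: eq_map => w /=; rewrite /unwind_vertex; case: eqP.
- by apply/allP => _ /mapP[w _ ->]; case: (PfE w).
Qed.

(** The empty path from the root must already meet a box. Hence neither [subst_vertex] nor
    [fix_vertex] moves the root. *)
Lemma modalised_root (p : nat) (psi : cformula) :
  modalised p psi -> lab (gr_root psi) != LVar p.
Proof.
move=> mod_psi; apply/eqP => rootp.
by have := mod_psi [::] isT rootp; rewrite /= /is_box rootp orbF => /eqP.
Qed.

(** The target is [fix_graph] rather than [fixpoint] because the [p]-labelled vertices of the copy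
    of [psi] survive only in the unpruned graph; there they keep their label, so [xpredT]
    suffices. *)
Lemma bisimilar_subst_fixpoint (p : nat) (psi : cformula)
    (mod_psi : modalised p psi) :
  bisimilar (subst_graph p psi (fixpoint mod_psi)) (fix_graph p psi).
Proof.
pose f (v : subst_graph p psi (fixpoint mod_psi)) : fix_graph p psi :=
  match v with inl a => a | inr b => val b end.
have fE (w : psi) : f (subst_vertex p (fixpoint mod_psi) w) = fix_vertex p w.
  by rewrite /subst_vertex /fix_vertex; case: ifP.
apply: (bisimilar_map (f := f) (P := xpredT)) => //.
  by rewrite fE /fix_vertex (negPf (modalised_root mod_psi)).
case=> [a|b] _; split=> //; try exact/allP.
- by rewrite /= -map_comp; apply: eq_map.
- by rewrite /= -map_comp; exact: (@val_generate_succ (fix_graph p psi) b).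
Qed.

Theorem theorem3p2 :
  (forall (phi : cformula) (q : nat), ~~ occurs q phi ->
     CHL (cIff phi (unwind_subst q phi phi))) /\
  (forall (p : nat) (psi : cformula) (mod_psi : modalised p psi),
     CHL (cIff (fixpoint mod_psi) (subst p psi (fixpoint mod_psi)))).
Proof.
(* Symmetry puts the unfolded formula on the left, where the collapsing maps start. *)
split=> [phi q q_phi | p psi mod_psi]; apply/CHL_bisim/bisimilar_sym;
  apply: bisimilar_trans (bisimilar_generate _) _.
- exact: bisimilar_subst_unwind.
- apply: bisimilar_trans (bisimilar_subst_fixpoint mod_psi) _.
  exact: bisimilar_sym (bisimilar_generate _).
Qed.
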